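(* Let $G$ be a maximally edge-connected graph of order $m\geq 3$, and let $n\geq 4$. Then $$\lambda_3(G\boxtimes K_n)=\min\{\,n^2\delta(G),\ (n-1)(m+2e(G)),\ 3n\delta(G)+3n-9\,\}.$$
   Context: Graphs are finite and simple. The order of $G$ is $|V(G)|$, $e(G)=|E(G)|$, and $\delta(G)$ is the minimum degree of $G$. $K_n$ is the complete graph of order $n$. An edge subset $S\subseteq E(G)$ is an edge-cut if $G-S$ is disconnected; the edge-connectivity $\lambda(G)$ is the minimum cardinality of an edge-cut. $G$ is maximally edge-connected if $\lambda(G)=\delta(G)$. An edge subset $S\subseteq E(G)$ is a 3-restricted edge-cut if $G-S$ is disconnected and each component of $G-S$ has at least three vertices. $\lambda_3(G)$ is the minimum cardinality of a 3-restricted edge-cut of $G$ if one exists, and $\lambda_3(G)=+\infty$ otherwise. The strong product $G\boxtimes H$ has vertex set $V(G)\times V(H)$; two distinct vertices $(x_1,y_1)$, $(x_2,y_2)$ are adjacent iff $x_1=x_2$ and $y_1y_2\in E(H)$, or $y_1=y_2$ and $x_1x_2\in E(G)$, or $x_1x_2\in E(G)$ and $y_1y_2\in E(H)$. *)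

(* Defs.v *)
From HB Require Import structures.
From mathcomp Require Import all_boot.
Set Implicit Arguments.
Unset Strict Implicit.
Unset Printing Implicit Defensive.

Record sgraph := SGraph {
  vertex :> finType;
  adj : rel vertex;
  adj_sym : symmetric adj;
  adj_irr : irreflexive adj
}.

(* An edge xy is the two-element set [set x; y]. *)
Definition edges (G : sgraph) : {set {set G}} :=
  [set A | [exists x : G, [exists y : G, adj x y && (A == [set x; y])]]].

Definition degree (G : sgraph) (x : G) : nat := #|[set y | adj x y]|.

(* The default value #|G| exceeds every degree, so it only matters for the
   graph without vertices. *)
Definition min_degree (G : sgraph) : nat := \big[minn/#|G|]_(x : G) degree x.

Section DeleteEdges.
Variables (G : sgraph) (S : {set {set G}}).

Definition del_adj : rel G := fun x y => adj x y && ([set x; y] \notin S).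

Lemma del_adj_sym : symmetric del_adj.
Proof. by move=> x y; rewrite /del_adj adj_sym setUC. Qed.

Lemma del_adj_irr : irreflexive del_adj.
Proof. by move=> x; rewrite /del_adj adj_irr. Qed.

Definition del_edges : sgraph := SGraph del_adj_sym del_adj_irr.

End DeleteEdges.

Definition component (G : sgraph) (x : G) : {set G} :=
  [set y | connect (@adj G) x y].

Definition connected (G : sgraph) : bool :=
  [forall x : G, [forall y : G, connect (@adj G) x y]].

Definition edge_cut (G : sgraph) (S : {set {set G}}) : bool :=
  (S \subset edges G) && ~~ connected (del_edges S).

Definition restricted3_edge_cut (G : sgraph) (S : {set {set G}}) : bool :=
  edge_cut S && [forall x : del_edges S, 3 <= #|component x|].

(* [None] stands for +oo: no set satisfies P. *)
Definition min_card (T : finType) (P : pred {set T}) : option nat :=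
  if [pick S | P S] is Some S0 then Some #|[arg min_(S < S0 | P S) #|S|]|
  else None.

Definition edge_connectivity (G : sgraph) : option nat :=
  min_card (@edge_cut G).

Definition lambda3 (G : sgraph) : option nat :=
  min_card (@restricted3_edge_cut G).

Definition maximally_edge_connected (G : sgraph) : Prop :=
  edge_connectivity G = Some (min_degree G).

Section Complete.
Variable n : nat.

Definition complete_adj : rel 'I_n := fun x y => x != y.

Lemma complete_adj_sym : symmetric complete_adj.
Proof. by move=> x y; rewrite /complete_adj eq_sym. Qed.

Lemma complete_adj_irr : irreflexive complete_adj.
Proof. by move=> x; rewrite /complete_adj eqxx. Qed.

Definition complete_graph : sgraph := SGraph complete_adj_sym complete_adj_irr.

End Complete.

Section StrongProduct.
Variables G H : sgraph.

Definition strong_adj : rel (G * H)%type := fun u v =>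
  (u != v) &&
  [|| (u.1 == v.1) && adj u.2 v.2,
      (u.2 == v.2) && adj u.1 v.1
    | adj u.1 v.1 && adj u.2 v.2].

Lemma strong_adj_sym : symmetric strong_adj.
Proof.
move=> u v; rewrite /strong_adj (eq_sym u) (eq_sym u.1) (eq_sym u.2).
by rewrite (adj_sym u.1) (adj_sym u.2).
Qed.

Lemma strong_adj_irr : irreflexive strong_adj.
Proof. by move=> u; rewrite /strong_adj eqxx. Qed.

Definition strong_product : sgraph := SGraph strong_adj_sym strong_adj_irr.

End StrongProduct.

(* Main.v *)
Require Import Defs.
From HB Require Import structures.
From mathcomp Require Import all_boot.
From mathcomp Require Import zify.
Set Implicit Arguments.
Unset Strict Implicit.
Unset Printing Implicit Defensive.

(** Since the columns {x} x K_n are cliques of twins, the number of edges leaving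
    a vertex set A depends only on the column sizes a_x = |A ∩ ({x} x K_n)|:
      |∂A| = \sum_x a_x (n - a_x) + \sum_{x ~ y} a_x (n - a_y),
    the second sum ranging over ordered adjacent pairs.  This is bounded below
    whenever |A| and its complement have at least 3 elements.
    - If 0 < a_x < n for all x, each term is at least its value for a = 1, which
      gives (n-1)(m + 2e(G)).
    - Otherwise, up to complementing A, some a_x is 0; let h = max a.  The level
      sets {x | j < a_x} with j < h are proper and nonempty, so each has at least
      δ leaving edges in G; summing, |∂A| >= nδh + h(n - h).  For 3 <= h this
      concave function of h is at least the smaller of its values at 3 and n,
      3nδ + 3n - 9 and n^2 δ.
    - If h <= 2, put s = |A|.  Then |∂A| >= s (n-2)(δ+1), enough for s >= 6, and
      degree counting gives |∂A| >= s (n(δ+1) - s), enough for s <= 5.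
    The three values are attained by a column, a layer and a triangle inside a
    column, at a vertex of minimum degree. *)

(** * Minimum cardinalities and unordered pairs *)

Lemma min_card_eqP (T : finType) (P : pred {set T}) (k : nat) :
  min_card P = Some k <->
  (exists2 S, P S & #|S| = k) /\ (forall S, P S -> k <= #|S|).
Proof.
rewrite /min_card; split.
  case: pickP => [S0 PS0|//] [<-].
  by case: arg_minnP => // S PS minS; split=> //; exists S.
case=> [[S PS cS] minS]; case: pickP => [S0 PS0|/(_ S)]; last by rewrite PS.
case: arg_minnP => // S1 PS1 min1; congr Some; apply/eqP.
by rewrite eqn_leq minS // -cS min1.
Qed.

Lemma set2_inj (T : finType) (x y u v : T) :
  [set x; y] = [set u; v] -> (x, y) = (u, v) \/ (x, y) = (v, u).
Proof.
move=> eqE.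
have : x \in [set u; v] by rewrite -eqE set21.
have : y \in [set u; v] by rewrite -eqE set22.
have : u \in [set x; y] by rewrite eqE set21.
have : v \in [set x; y] by rewrite eqE set22.
rewrite !in_set2.
by do 4![case/orP=> /eqP ?]; subst; auto.
Qed.

(** * Boundaries of vertex sets, minimum degree and degree sums *)

Section Cuts.
Variable G : sgraph.
Implicit Types (X D : {set G}) (S : {set {set G}}) (x y : G).

Definition cut_size X : nat := \sum_(x in X) \sum_(y in ~: X) adj x y.

Definition boundary X : {set {set G}} :=
  [set [set p.1; p.2] | p in [set p : G * G | [&& p.1 \in X, p.2 \notin X
                                               & adj p.1 p.2]]].

(** Each boundary edge has exactly one orientation leading out of [X], so passing from ordered pairs
    to edges is injective. *)
Lemma card_boundary X : #|boundary X| = cut_size X.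
Proof.
rewrite card_in_imset; last first.
  move=> [x y] [u v]; rewrite !inE /= => /and3P[xX yX _] /and3P[uX vX _].
  by case/set2_inj=> // -[ex ey]; rewrite ex (negPf vX) in xX.
rewrite /cut_size pair_big_dep /= -sum1_card big_mkcond [RHS]big_mkcond /=.
apply: eq_bigr => -[x y] _; rewrite !inE /=.
by case: (x \in X); case: (y \in X); case: (adj x y).
Qed.

Lemma boundary_sub_edges X : boundary X \subset edges G.
Proof.
apply/subsetP=> e /imsetP[[x y]]; rewrite !inE /= => /and3P[_ _ xy] ->.
by apply/existsP; exists x; apply/existsP; exists y; rewrite xy eqxx.
Qed.

Lemma mem_boundary X x y :
  adj x y -> ([set x; y] \in boundary X) = ((x \in X) != (y \in X)).
Proof.
move=> xy; apply/imsetP/idP => [[[u v]]|].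
  rewrite !inE /= => /and3P[uX vX _] /set2_inj[] [-> ->];
    by rewrite uX (negPf vX).
case xX: (x \in X); case yX: (y \in X) => // _.
  by exists (x, y); rewrite // !inE xX yX.
by exists (y, x); rewrite /= 1?setUC // !inE /= xX yX adj_sym.
Qed.

Lemma del_boundary_adj X x y :
  @del_adj G (boundary X) x y = adj x y && ((x \in X) == (y \in X)).
Proof.
by rewrite /del_adj; case xy: (adj x y); rewrite // mem_boundary // negbK.
Qed.

Lemma del_boundary_connect X x y :
  connect (@del_adj G (boundary X)) x y -> (x \in X) = (y \in X).
Proof.
case/connectP=> p; elim: p x => [|z p IH] x /=; first by move=> _ ->.
case/andP; rewrite del_boundary_adj => /andP[_ /eqP->]; exact: IH.
Qed.

Lemma boundary_edge_cut X x y :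
  x \in X -> y \notin X -> edge_cut (boundary X).
Proof.
move=> xX yX; rewrite /edge_cut boundary_sub_edges.
apply/negP=> /forallP/(_ x)/forallP/(_ y) c.
by move: yX; rewrite -(del_boundary_connect c) xX.
Qed.

(** The form in which maximal edge-connectivity enters the lower bound: it is applied to level sets
    of column sizes. *)
Lemma min_degree_le_cut_size X x y :
  maximally_edge_connected G -> x \in X -> y \notin X ->
  min_degree G <= cut_size X.
Proof.
move=> /min_card_eqP[_ minS] xX yX.
by rewrite -card_boundary minS // (boundary_edge_cut xX yX).
Qed.

Lemma boundary_restricted3_edge_cut X x y :
  x \in X -> y \notin X ->
  (forall z, exists D, 2 < #|D| /\
     forall w, w \in D -> connect (@del_adj G (boundary X)) z w) ->
  restricted3_edge_cut (boundary X).
Proof.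
move=> xX yX big; rewrite /restricted3_edge_cut (boundary_edge_cut xX yX).
apply/forallP=> z; case: (big z) => D [D3 zD].
apply: leq_trans D3 _; apply/subset_leq_card/subsetP=> w wD.
by rewrite inE; apply: zD.
Qed.

(** Take for [X] one component left after deleting [S]. Its complement contains another component,
    and every edge leaving [X] must lie in [S]. Hence only boundaries have to be bounded from
    below. *)
Lemma restricted3_edge_cut_boundary S :
  restricted3_edge_cut S ->
  exists X, [/\ 2 < #|X|, 2 < #|~: X| & cut_size X <= #|S|].
Proof.
case/andP=> /andP[_ /forallPn[/= x /forallPn[/= y xy]]] /forallP/= big.
have csym : connect_sym (@del_adj G S).
  by apply: sym_connect_sym; apply: del_adj_sym.
exists [set z | connect (@del_adj G S) x z]; split; first exact: big.
  apply: leq_trans (big y) _; apply/subset_leq_card/subsetP=> z.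
  rewrite !inE => yz; apply: contra xy => xz.
  by apply: connect_trans xz _; rewrite csym.
rewrite -card_boundary; apply/subset_leq_card/subsetP=> e.
case/imsetP=> -[u v]; rewrite !inE /= => /and3P[xu xv uv] ->.
apply: contraR xv => uvS; apply: connect_trans xu (connect1 _).
by rewrite /del_adj uv uvS.
Qed.

Lemma degree_sum x : degree x = \sum_y adj x y.
Proof.
rewrite /degree -sum1_card big_mkcond; apply: eq_bigr => y _.
by rewrite inE; case: (adj x y).
Qed.

Lemma min_degree_le x : min_degree G <= degree x.
Proof.
rewrite /min_degree; have : x \in index_enum G by rewrite mem_index_enum.
elim: (index_enum G) => // z s IH; rewrite inE big_cons geq_min.
by case/orP=> [/eqP<-|/IH ->]; rewrite ?leqnn ?orbT.
Qed.

Lemma min_degree_attained x0 : exists x, degree x = min_degree G.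
Proof.
pose x := [arg min_(x < x0) degree x]; exists x; apply/eqP.
rewrite eqn_leq min_degree_le andbT /x; case: arg_minnP => // z _ minz.
(* The default value [#|G|] of the iterated minimum is at least every degree. *)
rewrite /min_degree; elim/big_rec: _ => [|y k _ le].
  by rewrite max_card.
by rewrite leq_min minz.
Qed.

Lemma handshake : \sum_(x : G) \sum_(y : G) adj x y = 2 * #|edges G|.
Proof.
rewrite pair_big /=.
rewrite (eq_bigr (fun p : G * G => if adj p.1 p.2 then 1 else 0)); last first.
  by move=> p _; case: adj.
rewrite -big_mkcond /=.
(* Group the ordered adjacent pairs by their edge; each class consists of the two orientations. *)
rewrite (partition_big (fun p : G * G => [set p.1; p.2]) (mem (edges G))) /=.
  rewrite mulnC -sum_nat_const; apply: eq_bigr => e; rewrite inE.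
  case/existsP=> u /existsP[v /andP[uv /eqP->]].
  rewrite (_ : 2 = #|[set (u, v); (v, u)]|); last first.
    rewrite cards2; case: eqP => // -[uE _].
    by rewrite uE adj_irr in uv.
  rewrite -sum1_card; apply: eq_bigl => -[x y] /=; rewrite in_set2.
  apply/andP/orP => [[_ /eqP/set2_inj[->|->]]|]; rewrite ?eqxx; auto.
  by case=> /eqP[-> ->]; split; rewrite // 1?adj_sym // setUC.
move=> [x y] /= xy; rewrite inE; apply/existsP; exists x; apply/existsP.
by exists y; rewrite xy eqxx.
Qed.

End Cuts.

(** * Lower bounds for cuts described by column sizes *)

Lemma inner_mul n b : 0 < b < n -> n - 1 <= b * (n - b).
Proof.
case: b => // b bn; have [c ->] : exists c, n = b.+1 + c.+1.
  by exists (n - b.+2); lia.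
by rewrite addKn mulSn mulnS; lia.
Qed.

(** For positive p and q, pq >= p + q - 1; adding the two instances cancels b and c. *)
Lemma inner_cross_mul n b c : 0 < b < n -> 0 < c < n ->
  2 * (n - 1) <= b * (n - c) + c * (n - b).
Proof.
case: b => // b bn; case: c => // c cn.
have [d dE] : exists d, n - b.+1 = d.+1 by exists (n - b.+2); lia.
have [e eE] : exists e, n - c.+1 = e.+1 by exists (n - c.+2); lia.
by rewrite dE eE !mulSn !mulnS; lia.
Qed.

Section Weights.
Variable G : sgraph.
Implicit Types a : G -> nat.

(* The size of the cut of the strong product with K_n around a set meeting the
   column of x in [a x] vertices. *)
Definition weight_cut n a : nat :=
  \sum_x a x * (n - a x) + \sum_x \sum_y adj x y * (a x * (n - a y)).

Lemma eq_weight_cut n a b : a =1 b -> weight_cut n a = weight_cut n b.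
Proof.
move=> ab; rewrite /weight_cut; congr (_ + _); apply: eq_bigr => x _.
  by rewrite ab.
by apply: eq_bigr => y _; rewrite !ab.
Qed.

Lemma weight_cut_compl n a : (forall x, a x <= n) ->
  weight_cut n (fun x => n - a x) = weight_cut n a.
Proof.
move=> an; rewrite /weight_cut; congr (_ + _).
  by apply: eq_bigr => x _; rewrite subKn // mulnC.
rewrite exchange_big; apply: eq_bigr => x _; apply: eq_bigr => y _ /=.
by rewrite subKn // adj_sym [_ * a x]mulnC.
Qed.

Lemma leq_mul_degree a :
  (\sum_x a x) * min_degree G <= \sum_x \sum_y adj x y * a x.
Proof.
rewrite big_distrl; apply: leq_sum => x _ /=; rewrite -big_distrl /=.
by rewrite -degree_sum mulnC leq_mul2r min_degree_le orbT.
Qed.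

(** Counting a vertex as its own neighbour, each of the [s] chosen vertices has at least n(δ+1)
    neighbours, and at most s^2 ordered pairs stay inside. The term [s * s] is on the right to avoid
    truncated subtraction. *)
Lemma weight_cut_ge_card n a s : (forall x, a x <= n) -> s = \sum_x a x ->
  s * (n * (min_degree G).+1) <= weight_cut n a + s * s.
Proof.
move=> an sE.
have sqE : \sum_x a x * a x + \sum_x \sum_y adj x y * (a x * a y) <= s * s.
  rewrite {1}sE big_distrl /= -big_split /=; apply: leq_sum => x _.
  rewrite sE [in leqRHS](bigD1 x) //= mulnDr leq_add2l.
  rewrite (bigD1 x) //= adj_irr add0n big_distrr /=; apply: leq_sum => y _.
  by case: (adj x y); rewrite ?mul1n.
have E1 : \sum_x a x * (n - a x) + \sum_x a x * a x = n * s.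
  rewrite -big_split sE big_distrr; apply: eq_bigr => x _ /=.
  by rewrite -mulnDr subnK // mulnC.
have E2 : \sum_x \sum_y adj x y * (a x * (n - a y))
    + \sum_x \sum_y adj x y * (a x * a y)
    = n * \sum_x \sum_y adj x y * a x.
  rewrite -big_split big_distrr; apply: eq_bigr => x _ /=.
  rewrite -big_split big_distrr; apply: eq_bigr => y _ /=.
  by rewrite -mulnDr -mulnDr subnK //; lia.
have := leq_mul_degree a; rewrite -sE /weight_cut => D.
have : n * (s * min_degree G) <= n * \sum_x \sum_y adj x y * a x.
  by rewrite leq_mul2l D orbT.
by move: E1 E2 sqE; lia.
Qed.

(** Each chosen vertex sees at least n - h unchosen ones in its own column and in each of at least δ
    adjacent columns. *)
Lemma weight_cut_ge_flat n h a s : (forall x, a x <= h) -> s = \sum_x a x ->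
  s * ((n - h) * (min_degree G).+1) <= weight_cut n a.
Proof.
move=> ah sE; have D := leq_mul_degree a; rewrite -sE in D.
have L1 : (n - h) * s <= \sum_x a x * (n - a x).
  rewrite sE big_distrr; apply: leq_sum => x _ /=.
  by rewrite mulnC leq_mul2l leq_sub2l // orbT.
have L2 : (n - h) * \sum_x \sum_y adj x y * a x
    <= \sum_x \sum_y adj x y * (a x * (n - a y)).
  rewrite big_distrr; apply: leq_sum => x _ /=.
  rewrite big_distrr; apply: leq_sum => y _ /=.
  rewrite mulnCA leq_mul2l; apply/orP; right.
  by rewrite mulnC leq_mul2l leq_sub2l // orbT.
rewrite /weight_cut.
have : (n - h) * (s * min_degree G) <= (n - h) * \sum_x \sum_y adj x y * a x.
  by rewrite leq_mul2l D orbT.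
by move: L1 L2; lia.
Qed.

Lemma weight_cut_ge_inner n a : (forall x, 0 < a x < n) ->
  (n - 1) * (#|G| + 2 * #|edges G|) <= weight_cut n a.
Proof.
move=> an; rewrite -handshake /weight_cut mulnDr.
apply: leq_add.
  rewrite mulnC -sum_nat_const; apply: leq_sum => x _.
  by apply: inner_mul.
(* Double the sum and swap [x] and [y] in one copy, since [inner_cross_mul] bounds only the
   symmetrized term. *)
rewrite -(leq_pmul2l (isT : 0 < 2)) [leqRHS]mul2n -addnn.
rewrite [X in _ <= _ + X]exchange_big /= -big_split /= mulnA big_distrr /=.
apply: leq_sum => x _; rewrite -big_split big_distrr /=.
apply: leq_sum => y _; rewrite (adj_sym y x) -mulnDr mulnC leq_mul2l.
by rewrite inner_cross_mul ?orbT.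
Qed.

Hypothesis G_mec : maximally_edge_connected G.

(* a x - a y is truncated: it counts the levels j with a y <= j < a x. *)
Lemma sum_sub_ge_layers h a x0 x1 : a x0 = 0 -> a x1 = h ->
  h * min_degree G <= \sum_x \sum_y adj x y * (a x - a y).
Proof.
move=> a0 ah.
have subE x y : \sum_(j < h) ((j < a x) && (a y <= j)) <= a x - a y.
  (* Capping [a x] at [h] makes the bound strong enough for induction on the number of levels. *)
  apply: (@leq_trans (minn (a x) h - a y)); last by rewrite leq_sub2r ?geq_minl.
  elim: h {ah} => [|k IH]; first by rewrite big_ord0.
  rewrite big_ord_recr /=; apply: leq_trans (leq_add IH (leqnn _)) _.
  by case: ltnP => kx; case: leqP => ky /=; lia.
apply: (@leq_trans (\sum_x \sum_y \sum_(j < h)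
    adj x y * ((j < a x) && (a y <= j)))); last first.
  apply: leq_sum => x _; apply: leq_sum => y _.
  by rewrite -big_distrr leq_mul2l subE orbT.
rewrite (eq_bigr (fun x => \sum_(j < h) \sum_y
    adj x y * ((j < a x) && (a y <= j)))); last by move=> x _; rewrite exchange_big.
rewrite exchange_big /= -[h in h * _]card_ord -sum_nat_const.
apply: leq_sum => j _.
have := @min_degree_le_cut_size G [set x | j < a x] x1 x0 G_mec.
rewrite !inE ah a0 ltn_ord => /(_ isT isT) /leq_trans; apply.
rewrite /cut_size big_mkcond /=; apply: leq_sum => x _.
rewrite inE; case: ltnP => // _; rewrite big_mkcond; apply: leq_sum => y _.
by rewrite !inE -leqNgt; case: (a y <= j); rewrite ?muln1.
Qed.

(* Symmetrizing over (x, y): a_x (n - a_y) + a_y (n - a_x) >= n |a_x - a_y|. *)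
Lemma weight_cut_ge_layers n h a x0 x1 : (forall x, a x <= n) ->
  a x0 = 0 -> a x1 = h ->
  n * h * min_degree G <= \sum_x \sum_y adj x y * (a x * (n - a y)).
Proof.
move=> an a0 ah; have := sum_sub_ge_layers a0 ah.
set T := \sum_x _ => hT; apply: (@leq_trans (n * T)).
  by rewrite -mulnA leq_mul2l hT orbT.
rewrite -(leq_pmul2l (isT : 0 < 2)) !mul2n -!addnn.
rewrite [X in _ + n * X]exchange_big [X in _ <= _ + X]exchange_big /=.
rewrite !big_distrr -!big_split /=.
apply: leq_sum => x _; rewrite !big_distrr -!big_split /=.
apply: leq_sum => y _; rewrite (adj_sym y x).
have := an x; have := an y; case: (adj x y); rewrite ?mul0n ?muln0 // !mul1n.
by move: (a x) (a y) => b c; nia.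
Qed.

Lemma weight_cut_ge_zero n a x0 :
  3 < n -> 0 < min_degree G -> (forall x, a x <= n) -> a x0 = 0 ->
  2 < \sum_x a x ->
  minn (n ^ 2 * min_degree G) (3 * n * min_degree G + 3 * n - 9)
    <= weight_cut n a.
Proof.
move=> n4 d1 an a0 s3.
pose x1 := [arg max_(x > x0) a x].
have ah x : a x <= a x1 by rewrite /x1; case: arg_maxnP => // z _; apply.
move: s3; set s := \sum_x a x => s3; rewrite geq_min; apply/orP.
have [h2|h3] := leqP (a x1) 2.
  right; have F := weight_cut_ge_flat n (fun x => leq_trans (ah x) h2) (erefl s).
  have S := weight_cut_ge_card an (erefl s).
  move: (weight_cut n a) (min_degree G) F S d1 => w d F S d1.
  have [s5|s6] := leqP s 5; last first.
    (* Here 6(n - 2) >= 3n because n >= 4. *)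
    apply: leq_trans F; apply: (@leq_trans (6 * ((n - 2) * d.+1))).
      apply: (@leq_trans (3 * n * d.+1)); first by rewrite mulnS; lia.
      by rewrite mulnA leq_mul2r; apply/orP; right; lia.
    by rewrite leq_mul2r s6 orbT.
  (* With N = n(δ+1), the bound sN - s^2 >= 3N - 9 is an equality for s = 3, needs N >= 7 for s = 4
     and N >= 8 for s = 5. *)
  have : 8 <= n * d.+1 by apply: (@leq_mul 4 2).
  have -> : 3 * n * d + 3 * n = 3 * (n * d.+1) by rewrite mulnS; lia.
  move: (n * _) S => N S N8.
  have : (s == 3) || (s == 4) || (s == 5) by lia.
  by case/orP=> [/orP[]|] /eqP sE; move: S; rewrite sE; lia.
have L := weight_cut_ge_layers an a0 (erefl (a x1)).
have : a x1 * (n - a x1) <= \sum_x a x * (n - a x).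
  by rewrite (bigD1 x1) //= leq_addr.
move: L (an x1); rewrite /weight_cut.
move: (a x1) (min_degree G) h3 d1 => h d h3 d1.
move=> L; rewrite leq_eqVlt => /orP[/eqP hn|hn] C; [left | right].
  by rewrite hn in L; rewrite -mulnn (leq_trans L) ?leq_addl.
(* The gap nδh + h(n - h) - (3nδ + 3n - 9) factors as (h - 3)(nδ + n - h - 3), which is nonnegative
   since nδ >= 4 and h < n. *)
have [k hE] : exists k, h = k + 3 by exists (h - 3); lia.
have [e nE] : exists e, n = h + e.+1 by exists (n - h.+1); lia.
have : k * 4 <= k * (n * d) by rewrite leq_mul2l (leq_trans n4) ?orbT ?leq_pmulr.
by move: L C; rewrite nE hE; nia.
Qed.

Lemma weight_cut_ge n a :
  3 < n -> 0 < min_degree G -> (forall x, a x <= n) ->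
  2 < \sum_x a x -> 2 < \sum_x (n - a x) ->
  minn (n ^ 2 * min_degree G)
       (minn ((n - 1) * (#|G| + 2 * #|edges G|))
             (3 * n * min_degree G + 3 * n - 9)) <= weight_cut n a.
Proof.
move=> n4 d1 an s3 t3; rewrite minnCA geq_min; apply/orP.
case: (pickP (fun x => a x == 0)) => [x0 /eqP a0|pos].
  by right; apply: weight_cut_ge_zero a0 _.
case: (pickP (fun x => a x == n)) => [x1 /eqP a1|neq_n].
  right; rewrite -(weight_cut_compl an).
  by apply: (@weight_cut_ge_zero _ _ x1); rewrite ?a1 ?subnn // => x; apply: leq_subr.
left; apply: weight_cut_ge_inner => x.
by rewrite lt0n pos ltn_neqAle neq_n an.
Qed.

End Weights.

(** * Weights of the three extremal configurations *)

Lemma weight_cut_single (G : sgraph) n k (x : G) :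
  weight_cut n (fun y => (y == x) * k) = k * (n - k) + k * n * degree x.
Proof.
rewrite /weight_cut; congr (_ + _).
  rewrite (bigD1 x) //= eqxx mul1n big1 ?addn0 // => y /negPf->.
  by rewrite mul0n.
rewrite (bigD1 x) //= [X in _ + X]big1 ?addn0 => [|y /negPf->]; last first.
  by apply: big1 => z _; rewrite muln0.
rewrite degree_sum big_distrr; apply: eq_bigr => y _ /=.
rewrite eqxx mul1n mulnC; case: eqP => [->|]; first by rewrite adj_irr !muln0.
by rewrite mul0n subn0.
Qed.

Lemma weight_cut_one (G : sgraph) n :
  weight_cut n (fun _ : G => 1) = (n - 1) * (#|G| + 2 * #|edges G|).
Proof.
rewrite /weight_cut sum_nat_const mulnDr -handshake; congr (_ + _).
  by rewrite mulnC mul1n.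
rewrite big_distrr; apply: eq_bigr => x _; rewrite big_distrr; apply: eq_bigr => y _.
by rewrite mul1n mulnC.
Qed.

(** * Cuts of the strong product and the three extremal cuts *)

Section Product.
Variables (G : sgraph) (n : nat).
Let P := strong_product G (complete_graph n).
Implicit Types (X : {set P}) (x y : G) (i j : 'I_n).

Definition fiber_size X x : nat := \sum_(i < n) (((x, i) : P) \in X).

Lemma sum_product (F : P -> nat) : \sum_u F u = \sum_x \sum_(i < n) F (x, i).
Proof. by rewrite pair_bigA; apply: eq_bigr => -[]. Qed.

Lemma sum_fiber_size X : \sum_x fiber_size X x = #|X|.
Proof.
rewrite -sum1_card [RHS]big_mkcond sum_product; apply: eq_bigr => x _.
by apply: eq_bigr => i _; case: (_ \in X).
Qed.

Lemma fiber_size_le X x : fiber_size X x <= n.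
Proof.
rewrite -[leqRHS]card_ord -sum1_card; apply: leq_sum => i _; exact: leq_b1.
Qed.

Lemma fiber_sizeC X x : fiber_size (~: X) x = n - fiber_size X x.
Proof.
apply/eqP; rewrite -(eqn_add2r (fiber_size X x)) subnK ?fiber_size_le //.
rewrite -big_split -[eqbRHS]card_ord -sum1_card; apply/eqP/eq_bigr => i _.
by rewrite inE; case: (_ \in X).
Qed.

Lemma adj_product (u v : P) :
  adj u v = (u != v) && ((u.1 == v.1) || adj u.1 v.1).
Proof.
case: u v => [x i] [y j]; rewrite /= /strong_adj /= /complete_adj xpair_eqE.
case: (eqVneq x y) => [->|_]; case: (eqVneq i j) => _;
  by rewrite /= ?eqxx ?adj_irr ?andbT ?andbF ?orbF.
Qed.

(** A vertex of [X] in column x is joined to every vertex outside [X] in column x and in the columns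
    of the neighbours of x. *)
Lemma cut_size_product X : cut_size X = weight_cut n (fiber_size X).
Proof.
rewrite /cut_size /weight_cut -big_split big_mkcond sum_product.
apply: eq_bigr => x _.
transitivity (\sum_(i < n) (((x, i) : P) \in X) *
   (\sum_y ((x == y) || adj x y) * (n - fiber_size X y))).
  apply: eq_bigr => i _; case: ifP => // xiX; rewrite mul1n.
  rewrite big_mkcond sum_product; apply: eq_bigr => y _.
  rewrite -fiber_sizeC big_distrr; apply: eq_bigr => j _.
  rewrite adj_product inE /=; case: ifP => yjX; rewrite ?muln0 // muln1.
  by case: eqP => // eq_uv; rewrite -eq_uv xiX in yjX.
rewrite -big_distrl /= -/(fiber_size X x) (bigD1 x) //= eqxx mul1n mulnDr.
congr (_ + _); rewrite [RHS](bigD1 x) //= adj_irr add0n big_distrr.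
by apply: eq_bigr => y /negPf xy; rewrite eq_sym xy mulnCA.
Qed.

(** Used with [k] equal to [n] for a whole column and to 3 for a triangle. *)
Definition column_part x k : {set P} := [set u : P | (u.1 == x) && (u.2 < k)].

Lemma fiber_size_column_part x k y :
  k <= n -> fiber_size (column_part x k) y = (y == x) * k.
Proof.
move=> kn; rewrite /fiber_size.
rewrite (eq_bigr (fun i : 'I_n => (y == x) * (i < k))) => [|i _]; last first.
  by rewrite inE /=; case: (y == x); rewrite ?mul1n.
rewrite -big_distrr /= -[in RHS](minn_idPr kn); congr (_ * _).
elim: n => [|l IH]; first by rewrite big_ord0 min0n.
by rewrite big_ord_recr /= IH; case: ltnP; lia.
Qed.

Lemma card_column_part x k : k <= n -> #|column_part x k| = k.
Proof.
move=> kn; rewrite -sum_fiber_size (bigD1 x) //= big1 => [|y /negPf yx].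
  by rewrite fiber_size_column_part // eqxx mul1n addn0.
by rewrite fiber_size_column_part // yx.
Qed.

Lemma boundary_connect X (u v : P) :
  (u.1 == v.1) || adj u.1 v.1 -> (u \in X) = (v \in X) ->
  connect (@del_adj P (boundary X)) u v.
Proof.
move=> uv same; case: (eqVneq u v) => [->|neq]; first exact: connect0.
by apply: connect1; rewrite del_boundary_adj adj_product neq uv same eqxx.
Qed.

Hypothesis n_gt3 : 3 < n.

Lemma column_cut x y : x != y ->
  exists2 S : {set {set P}}, restricted3_edge_cut S & #|S| = n ^ 2 * degree x.
Proof.
move=> xy; have n0 : 0 < n by apply: leq_trans n_gt3.
exists (boundary (column_part x n)).
  apply: (@boundary_restricted3_edge_cut _ _
    ((x, Ordinal n0) : P) ((y, Ordinal n0) : P)).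
  - by rewrite inE /= eqxx.
  - by rewrite inE /= eq_sym (negPf xy).
  move=> z; exists (column_part z.1 n); rewrite card_column_part //.
  split=> [|w]; first exact: ltnW.
  rewrite inE => /andP[/eqP wz _]; apply: boundary_connect.
    by rewrite wz eqxx.
  by rewrite !inE wz !ltn_ord.
rewrite card_boundary cut_size_product.
rewrite (eq_weight_cut n (fun y => fiber_size_column_part x y (leqnn n))).
by rewrite weight_cut_single subnn muln0 add0n mulnn.
Qed.

Lemma triangle_cut x : 0 < degree x ->
  exists2 S : {set {set P}}, restricted3_edge_cut S &
    #|S| = 3 * n * degree x + 3 * n - 9.
Proof.
rewrite card_gt0 => /set0Pn[y]; rewrite inE => xy.
have yx : (y == x) = false by apply/eqP=> yx; rewrite yx adj_irr in xy.
have n0 : 0 < n by apply: leq_trans n_gt3.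
exists (boundary (column_part x 3)).
  apply: (@boundary_restricted3_edge_cut _ _
    ((x, Ordinal n0) : P) ((y, Ordinal n0) : P)).
  - by rewrite inE /= eqxx.
  - by rewrite inE /= yx.
  move=> z; have [zX|zX] := boolP (z \in column_part x 3).
    exists (column_part x 3); rewrite (card_column_part _ (ltnW n_gt3)).
    split=> // w wX; apply: boundary_connect; rewrite ?zX ?wX //.
    by move: zX wX; rewrite !inE => /andP[/eqP-> _] /andP[/eqP-> _]; rewrite eqxx.
  (* What remains of column [x] may be a single vertex (n = 4), so there the whole column of the
     neighbour [y] serves as witness. *)
  pose t := if z.1 == x then y else z.1.
  have tx : (t == x) = false by rewrite /t; case: ifP.
  exists (column_part t n); rewrite card_column_part //.
  split=> [|w]; [exact: ltnW | rewrite inE => /andP[/eqP wt _]].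
  apply: boundary_connect.
    by rewrite wt /t; case: (eqVneq z.1 x) => [->|_]; rewrite ?xy ?eqxx ?orbT.
  by rewrite (negPf zX) inE wt tx.
rewrite card_boundary cut_size_product.
rewrite (eq_weight_cut n (fun y => fiber_size_column_part x y (ltnW n_gt3))).
by rewrite weight_cut_single; lia.
Qed.

Lemma layer_cut : 2 < #|G| -> connected G ->
  exists2 S : {set {set P}}, restricted3_edge_cut S &
    #|S| = (n - 1) * (#|G| + 2 * #|edges G|).
Proof.
move=> G3 /forallP conG.
have n0 : 0 < n by apply: leq_trans n_gt3.
have n1 : 1 < n by apply: leq_trans n_gt3.
pose j0 := Ordinal n0; pose X := [set u : P | u.2 == j0].
have fX x : fiber_size X x = 1.
  rewrite /fiber_size (bigD1 j0) //= inE eqxx big1 // => i /negPf ij.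
  by rewrite inE /= ij.
have /card_gt0P[x _] : 0 < #|G| by apply: leq_trans G3.
exists (boundary X).
  apply: (@boundary_restricted3_edge_cut _ _
    ((x, j0) : P) ((x, Ordinal n1) : P)); rewrite ?inE //.
  move=> [y j]; have [->|jj0] := eqVneq j j0.
    (* The layer is a copy of the connected graph [G], so paths of [G] lift to it. *)
    exists X; rewrite -sum_fiber_size (eq_bigr _ (fun x _ => fX x)) sum1_card.
    split=> // -[w i]; rewrite inE /= => /eqP->.
    have /forallP/(_ w)/connectP[p] := conG y.
    elim: p y => [|z p IH] y /=; first by move=> _ ->; apply: connect0.
    case/andP=> yz pz lw; apply: connect_trans (IH z pz lw).
    by apply: boundary_connect; rewrite ?inE /= ?yz ?orbT.
  (* Off the layer, the rest of the column is a clique on n - 1 >= 3 vertices. *)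
  exists (column_part y n :\ ((y, j0) : P)).
  have := cardsD1 ((y, j0) : P) (column_part y n).
  rewrite card_column_part // inE /= eqxx n0 => nE; split; first by lia.
  move=> [w i]; rewrite !inE /= xpair_eqE => /and3P[iw /eqP wy _].
  rewrite wy eqxx /= in iw.
  by apply: boundary_connect; rewrite /= ?wy ?eqxx // !inE /= (negPf iw) (negPf jj0).
by rewrite card_boundary cut_size_product (eq_weight_cut n fX) weight_cut_one.
Qed.

End Product.

(** * Connectedness and the final formula *)

Lemma maximally_edge_connected_connected (G : sgraph) :
  maximally_edge_connected G -> 0 < min_degree G -> connected G.
Proof.
move=> /min_card_eqP[_ minS] d1; apply: contraLR d1 => ncon.
(* If [G] were disconnected, the empty set would be an edge-cut of size 0. *)
rewrite -leqNgt -(cards0 {set G}) minS // /edge_cut sub0set.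
apply: contra ncon => /forallP con; apply/forallP=> x; apply/forallP=> y.
have /forallP/(_ y) := con x; rewrite (@eq_connect _ _ (@adj G)) // => u v.
by rewrite /= /del_adj inE andbT.
Qed.

Theorem theorem3p2 (G : sgraph) (m n : nat)
    (hG : maximally_edge_connected G) (hm : #|G| = m)
    (hm3 : 3 <= m) (hn : 4 <= n) :
  lambda3 (strong_product G (complete_graph n)) =
    Some (minn (n ^ 2 * min_degree G)
         (minn ((n - 1) * (m + 2 * #|edges G|))
               (3 * n * min_degree G + 3 * n - 9))).
Proof.
subst m; have /card_gt0P[x0 _] : 0 < #|G| by apply: leq_trans hm3.
have [x dx] := min_degree_attained x0.
have [y xy] : exists y, x != y.
  have /card_gt0P[y] : 0 < #|[set~ x]| by rewrite cardsC1; lia.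
  by rewrite !inE eq_sym => ?; exists y.
have cutA := column_cut hn xy; rewrite dx in cutA.
apply/min_card_eqP; have [d0|d1] := posnP (min_degree G).
  (* When δ = 0 the minimum is 0, attained by a column with empty boundary. *)
  by rewrite d0 muln0 min0n; split=> //; rewrite d0 muln0 in cutA.
split.
  have := triangle_cut hn (x := x); rewrite dx => /(_ d1) cutC.
  have cutB := layer_cut hn hm3 (maximally_edge_connected_connected hG d1).
  by rewrite /minn; case: ifP => _ //; case: ifP.
move=> S /restricted3_edge_cut_boundary[X [X3 CX3]]; apply: leq_trans.
rewrite cut_size_product; apply: weight_cut_ge => //.
- exact: fiber_size_le.
- by rewrite sum_fiber_size.
by under eq_bigr => z _ do rewrite -fiber_sizeC; rewrite sum_fiber_size.
Qed.
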